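(* Suppose $M=M(n)=\Omega(n\log n)$. There is a constant $K$ such that if $p\ge \frac{Kn\log n}{M}$ then with probability tending to $1$ as $n\to\infty$, $G_{n,p}$ contains a Hamilton cycle $H$ with $\iota(H)\le M$. Furthermore, for any constant $\varepsilon>0$, if $p\le \frac{(1-\varepsilon)n}{eM}$ then with probability tending to $1$ as $n\to\infty$, $G_{n,p}$ contains no Hamilton cycle $H$ with $\iota(H)\le M$.
   Context: $G_{n,p}$ is the random graph on vertex set $[n]$ in which each of the $\binom n2$ possible edges is present independently with probability $p$. A Hamilton cycle $H$ is treated as the sequence $(i_1=1,i_2,\ldots,i_n)$ of its vertices listed in cyclic order starting from vertex $1$ (this sequence is a permutation of $[n]$), and its number of inversions is $\iota(H)=|\{(k,\ell):k<\ell,\ i_k>i_\ell\}|$.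
   Formalization: In the first part M is also assumed to be O(n^2), say M ≤ Cn^2 for large n, and K depends only on C; without such a bound (e.g. M = n^3) the claim fails, since G_{n,p} with p = Kn log n/M then has isolated vertices. *)

(* Defs.v *)
From mathcomp Require Import all_boot all_order all_algebra.
From mathcomp Require Import all_classical all_reals all_analysis.

Set Implicit Arguments.
Unset Strict Implicit.
Unset Printing Implicit Defensive.

Import Order.TTheory GRing.Theory Num.Theory.

(* Vertices 1, ..., n are encoded as the elements 0, ..., n-1 of 'I_n; the
   shift does not affect the order, and vertex 1 is the ordinal of value 0. *)
Definition edge_slots (n : nat) : {set {set 'I_n}} :=
  [set e : {set 'I_n} | #|e| == 2].

(* For G \subset edge_slots n this relation is symmetric and irreflexive
   (irreflexive because [set i; i] is a singleton). *)
Definition adj (n : nat) (G : {set {set 'I_n}}) : rel 'I_n :=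
  fun i j => [set i; j] \in G.

(* [ucycleb] accepts degenerate cycles of length at most 2, hence the
   bound on n.  Both traversals of a cycle from vertex 1 are such sequences. *)
Definition hamilton_cycle (n : nat) (G : {set {set 'I_n}})
    (c : n.-tuple 'I_n) : bool :=
  [&& 2 < n, ohead (map val c) == Some 0 & ucycleb (adj G) c].

Definition inversions (n : nat) (c : n.-tuple 'I_n) : nat :=
  #|[set kl : 'I_n * 'I_n |
      (kl.1 < kl.2) && (tnth c kl.2 < tnth c kl.1)]|.

Local Open Scope ring_scope.

Definition has_hamilton_cycle_le (R : realType) (n : nat) (m : R)
    (G : {set {set 'I_n}}) : bool :=
  [exists c : n.-tuple 'I_n,
    hamilton_cycle G c && ((inversions c)%:R <= m)].

(* The probability, in G_{n,p}, of the graph property P: graphs on the vertex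
   set are the sets of edge slots, weighted by the product measure in which
   the slots are present independently, each with probability p. *)
Definition Gnp_prob (R : realType) (n : nat) (p : R)
    (P : pred {set {set 'I_n}}) : R :=
  \sum_(G in powerset (edge_slots n) | P G)
    \prod_(e in edge_slots n) (if e \in G then p else 1 - p).

(* Main.v *)
Require Import Defs.
From mathcomp Require Import all_boot all_order all_algebra.
From mathcomp Require Import all_classical all_reals all_analysis.
From mathcomp Require Import fintype finset ring lra zify.
Import Order.TTheory GRing.Theory Num.Theory.
Import numFieldNormedType.Exports.

(** Existence: build a random cyclic order by inserting the vertices 1, 2, ...
    one at a time, each into one of the last m ~ M / n gaps.  Each insertion
    creates fewer than m inversions, and a given set of s edges lies on the
    resulting cycle with probability at most (4 e / m) ^ s: when the last vertex
    meets the edge set, only two gaps are possible and the vertex can be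
    contracted away.  A family that is q-spread in this sense is hit by a random
    set of density O(q log n), by the minimum-fragment argument of Park and Pham
    (after Frankston, Kahn, Narayanan and Park).

    Non-existence: first moment.  The Lehmer code and an exponential (Chernoff)
    weight bound the number of permutations with at most M inversions by
    (e (1 + M / n)) ^ n. *)

Set Implicit Arguments.
Unset Strict Implicit.
Unset Printing Implicit Defensive.

(** * Cycles as lists of edges *)

Section CycleEdges.
Variable V : finType.
Implicit Types (x y z h : V) (s t : seq V) (e : {set V}) (S : {set {set V}}).

Fixpoint path_edges x s : seq {set V} :=
  if s is y :: s' then [set x; y] :: path_edges y s' else [::].

(** A list rather than a set: entry [i] is the edge of the gap split by [insert_at _ s i], the last
    entry being the closing edge back to [h]. *)
Definition cycle_edges h s := path_edges h (rcons s h).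

Definition edge_set h s : {set {set V}} := [set e in cycle_edges h s].

Definition insert_at x s i := take i s ++ x :: drop i s.

Lemma path_edges_cat x s1 y s2 :
  path_edges x (s1 ++ y :: s2) =
  path_edges x s1 ++ [set last x s1; y] :: path_edges y s2.
Proof. by elim: s1 x => //= z s1 IH x; rewrite IH. Qed.

Lemma size_path_edges x s : size (path_edges x s) = size s.
Proof. by elim: s x => //= y s IH x; rewrite IH. Qed.

Lemma size_cycle_edges h s : size (cycle_edges h s) = (size s).+1.
Proof. by rewrite size_path_edges size_rcons. Qed.

Lemma mem_path_edges x s e y : e \in path_edges x s -> y \in e -> y \in x :: s.
Proof.
elim: s x => //= z s IH x; rewrite inE => /orP[/eqP->|/IH H /H].
  by rewrite !inE => /orP[/eqP->|/eqP->]; rewrite eqxx ?orbT.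
by rewrite !inE => /orP[]->; rewrite ?orbT.
Qed.

Lemma mem_cycle_edges h s e y : e \in cycle_edges h s -> y \in e -> y \in h :: s.
Proof.
by move=> /mem_path_edges H /H; rewrite inE mem_rcons inE orbA orbb.
Qed.

Lemma uniq_path_edges x s : uniq (x :: s) -> uniq (path_edges x s).
Proof.
elim: s x => //= y s IH x /andP[xys /IH ->]; rewrite andbT.
by apply: contra xys => /mem_path_edges; apply; rewrite !inE eqxx.
Qed.

Lemma uniq_cycle_edges h s :
  uniq (h :: s) -> 1 < size s -> uniq (cycle_edges h s).
Proof.
case: s => [|y [|z s]] //= /andP[hs /andP[ys zs]] _.
rewrite /cycle_edges /=; apply/andP; split.
  rewrite inE negb_or; apply/andP; split.
    apply/negP => /eqP/setP/(_ h); rewrite !inE eqxx /=.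
    by move: hs; rewrite !inE => /norP[/negbTE-> /norP[/negbTE->]].
  apply/negP => /mem_path_edges/(_ (set22 _ _)).
  rewrite inE mem_rcons inE; move: hs ys; rewrite !inE eq_sym.
  by case: (y == h) => //= _ /norP[/negbTE-> /negbTE->].
suff /uniq_path_edges : uniq (y :: rcons (z :: s) h) by [].
by rewrite -rcons_cons rcons_uniq /= hs ys zs.
Qed.

Lemma card_path_edge x s e :
  uniq (x :: s) -> e \in path_edges x s -> #|e| = 2.
Proof.
elim: s x => // y s IH x; rewrite cons_uniq [e \in _]inE => /andP[xs us] /orP[/eqP->|].
  by rewrite cards2; move: xs; rewrite inE => /norP[->].
exact: IH.
Qed.

Lemma card_cycle_edge h s e :
  uniq (h :: s) -> 0 < size s -> e \in cycle_edges h s -> #|e| = 2.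
Proof.
case: s => // y s /andP[hs us] _; rewrite inE => /orP[/eqP->|].
  by rewrite cards2; move: hs; rewrite inE => /norP[->].
by apply: card_path_edge; rewrite -rcons_cons rcons_uniq hs.
Qed.

Lemma count_cycle_edges_mem h s y :
  uniq (h :: s) -> count (fun e => y \in e) (cycle_edges h s) <= 2.
Proof.
move=> us.
have path_count x t : count (fun e => y \in e) (path_edges x t) <=
    count_mem y (belast x t) + count_mem y t.
  elim: t x => //= z t IH x; rewrite !inE.
  have := IH z; rewrite (eq_sym y x) (eq_sym y z).
  by case: (x == y); case: (z == y) => /=; lia.
apply: (leq_trans (path_count _ _)).
rewrite belast_rcons !count_uniq_mem ?rcons_uniq //.
by case: (y \in h :: s); case: (y \in rcons s h).
Qed.

Lemma insert_at_cycle_edges h s x i : i <= size s ->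
  exists P y z Q, [/\ size P = i, cycle_edges h s = P ++ [set y; z] :: Q &
    cycle_edges h (insert_at x s i) = P ++ [set y; x] :: [set x; z] :: Q].
Proof.
move=> ile; exists (path_edges h (take i s)), (last h (take i s)).
rewrite /cycle_edges /insert_at rcons_cat rcons_cons.
have -> : rcons s h = take i s ++ rcons (drop i s) h by rewrite -rcons_cat cat_take_drop.
case: (drop i s) => [|z t] /=; [exists h, [::]|exists z, (path_edges z (rcons t h))];
  by rewrite !path_edges_cat size_path_edges size_takel.
Qed.

Lemma perm_insert_at s x i : perm_eq (insert_at x s i) (x :: s).
Proof. by rewrite /insert_at perm_catC /= perm_cons perm_catC cat_take_drop. Qed.

Section Insert.
Variables (h x : V) (s : seq V) (i : nat).
Hypotheses (us : uniq (h :: s)) (s1 : 1 < size s) (xs : x \notin h :: s).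
Hypothesis ile : i <= size s.

Let cycle_notin e : e \in cycle_edges h s -> x \notin e.
Proof. by move=> es; apply: contra xs => /(mem_cycle_edges es). Qed.

(** An insertion removes the split edge and otherwise only adds edges at [x]. A set avoiding [x]
    thus comes from the old cycle and misses the split edge, which occurs only once since the edges
    are distinct. *)
Lemma insert_at_survive S : (forall e, e \in S -> x \notin e) ->
  S \subset edge_set h (insert_at x s i) ->
  S \subset edge_set h s /\ nth set0 (cycle_edges h s) i \notin S.
Proof.
move=> Sx /subsetP SE.
have [P [y [z [Q [sP E1 E2]]]]] := insert_at_cycle_edges h x ile.
have S_PQ e : e \in S -> e \in P ++ Q.
  move=> eS; have := SE _ eS; rewrite inE E2 mem_cat !inE mem_cat.
  have := Sx _ eS; case: eqP => [->|_]; first by rewrite !inE eqxx orbT.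
  by case: eqP => [->|//]; rewrite !inE eqxx.
split.
  apply/subsetP => e /S_PQ; rewrite inE E1 !mem_cat inE.
  by case/orP => ->; rewrite ?orbT.
rewrite E1 nth_cat sP ltnn subnn /=; apply/negP => /S_PQ.
have := uniq_cycle_edges us s1; rewrite E1 cat_uniq /= mem_cat negb_or.
by move=> /and3P[_ /andP[/negbTE-> _] /andP[/negbTE->]].
Qed.

Definition neighbours S : {set V} := [set y | [set x; y] \in S].

(** A path [y - x - z] of [S] becomes the edge [{y, z}]; a lone edge at [x] is dropped. Either way
    exactly one edge is lost. *)
Definition contract S : {set {set V}} :=
  let S0 := [set e in S | x \notin e] in
  if #|neighbours S| == 2 then neighbours S |: S0 else S0.

(** The edges of [S] at [x] are among the two new ones, so their other ends lie on the split edge.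
    With two neighbours the split edge enters the contraction, and it is new there because the part
    of [S] avoiding [x] misses it. *)
Lemma insert_at_contract S : (exists2 e, e \in S & x \in e) ->
  S \subset edge_set h (insert_at x s i) ->
  [/\ contract S \subset edge_set h s, #|S| = #|contract S|.+1,
      neighbours S \subset nth set0 (cycle_edges h s) i & neighbours S != set0].
Proof.
move=> [e0 e0S xe0] /subsetP SE.
have [P [y [z [Q [sP E1 E2]]]]] := insert_at_cycle_edges h x ile.
have nthE : nth set0 (cycle_edges h s) i = [set y; z].
  by rewrite E1 nth_cat sP ltnn subnn.
have yzE : [set y; z] \in cycle_edges h s by rewrite E1 mem_cat inE eqxx orbT.
have yz2 : #|[set y; z]| = 2 by rewrite (card_cycle_edge us _ yzE) // ltnW.
have := cycle_notin yzE; rewrite !inE negb_or => /andP[xy xz].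
have PQx e : e \in P ++ Q -> x \notin e.
  by rewrite mem_cat => eP; apply: cycle_notin; rewrite E1 mem_cat inE;
    case/orP: eP => ->; rewrite ?orbT.
have S_mem e : e \in S -> [|| e == [set x; y], e == [set x; z] | e \in P ++ Q].
  move=> /SE; rewrite inE E2 !mem_cat !inE [in [set x; y]]setUC.
  by case/or4P => ->; rewrite ?orbT.
have Sx e : e \in S -> x \in e -> exists2 w, w \in neighbours S & e = [set x; w].
  move=> eS xe; case/or3P: (S_mem _ eS) => [/eqP E|/eqP E|/PQx]; last by rewrite xe.
    by exists y => //; rewrite inE -E.
  by exists z => //; rewrite inE -E.
have pair_inj w w' : x != w -> [set x; w] = [set x; w'] -> w = w'.
  by move=> xw /setP/(_ w); rewrite !inE eqxx orbT eq_sym (negbTE xw) /= => /esym/eqP.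
have nbr_sub : neighbours S \subset [set y; z].
  apply/subsetP => w; rewrite !inE => /S_mem /or3P[/eqP E|/eqP E|/PQx].
  - by rewrite -(pair_inj _ _ xy (esym E)) eqxx.
  - by rewrite -(pair_inj _ _ xz (esym E)) eqxx orbT.
  - by rewrite !inE eqxx.
set S0 := [set e in S | x \notin e].
have cardS : #|S| = #|S0| + #|neighbours S|.
  rewrite -(cardsID [set e : {set V} | x \notin e] S); congr (_ + _).
    by apply: eq_card => e; rewrite !inE.
  rewrite -(@card_in_imset _ _ (fun w => [set x; w]) (neighbours S)).
    apply: eq_card => e; rewrite !inE negbK; apply/andP/imsetP.
      by case=> xe eS; have [w wN ->] := Sx _ eS xe; exists w.
    by case=> w; rewrite inE => wN ->; rewrite !inE eqxx.
  move=> w w' /(subsetP nbr_sub) wyz _; apply: pair_inj.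
  by move: wyz; rewrite !inE => /orP[]/eqP->.
have S0_sub : S0 \subset S by apply/subsetP => e; rewrite inE => /andP[].
have S0x e : e \in S0 -> x \notin e by rewrite inE => /andP[].
have [S0E S0i] : S0 \subset edge_set h s /\ nth set0 (cycle_edges h s) i \notin S0.
  apply: insert_at_survive => //; apply/subsetP => e /(subsetP S0_sub); exact: SE.
have nbr0 : neighbours S != set0.
  by have [w wN _] := Sx _ e0S xe0; apply/set0Pn; exists w.
rewrite nthE; split=> //; rewrite /contract -/S0.
  case: eqP => // N2; rewrite subUset S0E andbT sub1set.
  by rewrite inE (_ : neighbours S = [set y; z]) //; apply/eqP; rewrite eqEcard nbr_sub N2 yz2.
have N_le2 : #|neighbours S| <= 2 by rewrite -yz2 subset_leq_card.
move: nbr0; rewrite -card_gt0; case: eqP => N2 N0.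
  have NE : neighbours S = [set y; z] by apply/eqP; rewrite eqEcard nbr_sub N2 yz2.
  by rewrite cardS N2 cardsU1 NE -nthE S0i add1n addn2.
rewrite cardS (_ : #|neighbours S| = 1) ?addn1 //.
by move: N_le2 N2 N0; case: #|_| => [|[|[|]]].
Qed.

End Insert.
End CycleEdges.

(** * Inversions and Lehmer codes *)

Section ListInversions.
Implicit Types (x y : nat) (s t : seq nat).

Fixpoint lehmer s : seq nat :=
  if s is x :: s' then count (ltn^~ x) s' :: lehmer s' else [::].

Lemma lehmer_insert_max s1 x s2 : (forall y, y \in s1 ++ s2 -> y < x) ->
  sumn (lehmer (s1 ++ x :: s2)) = sumn (lehmer (s1 ++ s2)) + size s2.
Proof.
elim: s1 => [|z s1 IH] /= lt_x.
  by rewrite (eq_in_count (a2 := predT)) ?count_predT 1?addnC // => y /lt_x.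
have zx : z < x by rewrite lt_x ?mem_head.
rewrite IH => [|y ys]; last by rewrite lt_x // inE ys orbT.
by rewrite !count_cat /= [x < z]ltnNge ltnW //=; lia.
Qed.

(** The first code entry is the rank of the head among all entries, which depends on the multiset
    only. Equal codes thus force equal heads, and the tails follow by induction. *)
Lemma lehmer_inj s t : perm_eq s t -> uniq s -> lehmer s = lehmer t -> s = t.
Proof.
elim: s t => [|x s IH] [|y t] //= st; try by have := perm_size st.
move=> /andP[xs us] [cnt tl].
have cs : count (ltn^~ x) (x :: s) = count (ltn^~ y) (y :: t) by rewrite /= !ltnn cnt.
have xy : x = y.
  have ut : uniq (y :: t) by rewrite -(perm_uniq st) /= xs.
  rewrite (permP st) in cs.
  wlog : x y s t {IH xs us cnt tl} st ut cs / x <= y.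
    move=> H; case/orP: (leq_total x y) => [|yx]; first exact: (H _ _ s t).
    have cs' : count (ltn^~ y) (x :: s) = count (ltn^~ x) (x :: s).
      by rewrite !(permP st).
    by rewrite (H y x t s) // 1?perm_sym // (perm_uniq st).
  rewrite leq_eqVlt => /orP[/eqP//|xy].
  suff : count (ltn^~ x) (y :: t) < count (ltn^~ y) (y :: t) by rewrite cs ltnn.
  have xt : x \in y :: t by rewrite -(perm_mem st) mem_head.
  have := count_predUI (ltn^~ x) (pred1 x) (y :: t).
  rewrite [X in _ + X = _](_ : _ = 0); last first.
    by apply/eqP; rewrite -leqn0 leqNgt -has_count; apply/hasPn => z _ /=;
      apply/negP => /andP[zx /eqP zE]; rewrite zE ltnn in zx.
  rewrite [count (pred1 x) _]count_uniq_mem // xt addn0 addn1 => <-.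
  apply: sub_count => z /= /orP[zx|/eqP->//]; exact: ltn_trans xy.
by rewrite xy perm_cons in st *; rewrite (IH t st us tl).
Qed.

Lemma lehmer_bound n s : size s = n -> all (ltn^~ n) (lehmer s).
Proof.
suff H k : size s <= k -> all (ltn^~ k) (lehmer s) by move=> sn; apply: H; rewrite sn.
elim: s => //= x s IH sk; rewrite (IH (ltnW sk)) andbT.
by apply: leq_ltn_trans sk; apply: count_size.
Qed.

Lemma size_lehmer s : size (lehmer s) = size s.
Proof. by elim: s => //= x s ->. Qed.

Lemma sumn_lehmer s : sumn (lehmer s) =
  \sum_(k < size s) \sum_(l < size s) ((k < l) && (nth 0 s l < nth 0 s k)).
Proof.
elim: s => [|x s IH]; first by rewrite big_ord0.
rewrite /= big_ord_recl /= IH; congr (_ + _).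
  rewrite big_ord_recl /= add0n -sum1_count (big_nth 0) big_mkord big_mkcond /=.
  by apply: eq_bigr => l _; case: ifP.
apply: eq_bigr => k _; rewrite big_ord_recl /= add0n.
by apply: eq_bigr => l _ /=; rewrite /bump /= !add1n ltnS.
Qed.

Lemma inversionsE n (c : n.-tuple 'I_n) :
  inversions c = sumn (lehmer (map val c)).
Proof.
rewrite sumn_lehmer size_map size_tuple pair_big /= /inversions -sum1_card.
rewrite big_mkcond /=; apply: eq_bigr => -[k l] _ /=.
rewrite inE /= !(nth_map k) ?size_tuple // !(tnth_nth k).
by case: ifP.
Qed.

End ListInversions.

(** * A spread family of cycles with few inversions *)

Lemma sumn_map_le_count (T : eqType) (f : T -> nat) (P : pred T) c (l : seq T) :
  (forall s, s \in l -> f s <= c * P s) -> sumn (map f l) <= c * count P l.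
Proof.
elim: l => //= s l IH fP; rewrite mulnDr leq_add ?fP ?mem_head //.
by apply: IH => t tl; apply: fP; rewrite inE tl orbT.
Qed.

Lemma sub_in_count (T : eqType) (a b : pred T) (l : seq T) :
  {in l, forall x, a x -> b x} -> count a l <= count b l.
Proof.
move=> ab; rewrite (@eq_in_count _ a (predI a b)) => [|x /ab /=].
  by apply: sub_count => x /andP[].
by case: (a x) => // ->.
Qed.

Section InsertionFamily.
Variables n m : nat.
Implicit Types (s : seq 'I_n.+1) (S : {set {set 'I_n.+1}}).

(* The cycle [ord0 :: s] grows by inserting the vertices 1, ..., k in this
   order, each into one of the last m gaps; the number of inversions then grows
   by less than m. *)
Fixpoint insertion_family k : seq (seq 'I_n.+1) :=
  if k is k'.+1 then
    [seq insert_at (inord k'.+1) s i | s <- insertion_family k',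
       i <- iota (k'.+1 - minn k'.+1 m) (minn k'.+1 m)]
  else [:: [::]].

(** Divided by the size of the family, this is the probability that [S] lies on the cycle produced
    by uniform insertions. *)
Definition extensions k S : nat :=
  count (fun s => S \subset edge_set ord0 s) (insertion_family k).

Lemma size_insertion_family k :
  size (insertion_family k.+1) = minn k.+1 m * size (insertion_family k).
Proof. by rewrite size_allpairs size_iota mulnC. Qed.

Lemma insertion_familyP k s : k <= n -> s \in insertion_family k ->
  [/\ uniq (ord0 :: s), size s = k, forall v, v \in ord0 :: s -> val v <= k &
      sumn (lehmer (map val (ord0 :: s))) <= k * m].
Proof.
elim: k s => [|k IH] s kn.
  by rewrite inE => /eqP->; split=> // v; rewrite inE => /eqP->.
move=> sF.
have {sF s} [t [i [tF + ->]]] : exists t i, [/\ t \in insertion_family k,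
    i \in iota (k.+1 - minn k.+1 m) (minn k.+1 m) & s = insert_at (inord k.+1) t i].
  by case/allpairsP: sF => -[t i] [tF iI sE]; exists t, i.
rewrite mem_iota => /andP[ki ik1].
have [ut st tk lt] := IH _ (ltnW kn) tF.
have xk : val (inord k.+1 : 'I_n.+1) = k.+1 by rewrite /= inordK.
have ik : i <= k by rewrite -ltnS (leq_trans ik1) // subnK // geq_minl.
have xt : inord k.+1 \notin ord0 :: t.
  by apply/negP => /tk; rewrite xk ltnn.
have pe : perm_eq (ord0 :: insert_at (inord k.+1) t i) (inord k.+1 :: ord0 :: t).
  apply: (perm_trans (_ : perm_eq _ (ord0 :: inord k.+1 :: t))).
    by rewrite perm_cons perm_insert_at.
  exact/permPl/(perm_catCA [:: ord0] [:: inord k.+1] t).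
split.
- by rewrite (perm_uniq pe) cons_uniq xt.
- by have := perm_size pe => /= -[->]; rewrite st.
- move=> v; rewrite (perm_mem pe) inE => /orP[/eqP->|/tk/leqW//].
  by rewrite xk.
- rewrite /insert_at -cat_cons map_cat (map_cons _ (inord k.+1)) lehmer_insert_max.
    rewrite -map_cat cat_cons cat_take_drop size_map size_drop st mulSn addnC.
    by rewrite leq_add //; lia.
  move=> y; rewrite -map_cat cat_cons cat_take_drop => /mapP[v /tk vk ->].
  by rewrite xk ltnS.
Qed.

Lemma count_window (T : Type) (x0 : T) (P : pred T) (g : seq T) a w :
  a + w <= size g ->
  count (fun i => P (nth x0 g i)) (iota a w) <= count P g.
Proof.
move=> aw; rewrite -(count_map (nth x0 g) P) map_nth_iota; last by lia.
rewrite -[in leqRHS](cat_take_drop a g) count_cat.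
rewrite -[in leqRHS](cat_take_drop w (drop a g)) count_cat; lia.
Qed.

Lemma extensions_card k S : k <= n -> 0 < extensions k S -> #|S| <= k.+1.
Proof.
move=> kn; rewrite -has_count => /hasP[s /(insertion_familyP kn)[us sk _ _] SE].
rewrite (leq_trans (subset_leq_card SE)) // cardsE.
by rewrite (leq_trans (card_size _)) // size_cycle_edges sk.
Qed.

(** If [S] avoids the new vertex, the split gap is one of the [k.+1 - #|S|] edges outside [S].
    Otherwise the new vertex is contracted away, and at most two gaps are possible. *)
Lemma extensions_step k S : 1 < k -> k < n ->
  [\/ extensions k.+1 S = 0,
      extensions k.+1 S <= minn (minn k.+1 m) (k.+1 - #|S|) * extensions k S |
      exists2 S' : {set {set 'I_n.+1}}, #|S| = #|S'|.+1 & extensions k.+1 S <= 2 * extensions k S'].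
Proof.
move=> k1 kn; set w := minn k.+1 m; set x : 'I_n.+1 := inord k.+1.
have wk : k.+1 - w + w = k.+1 by rewrite subnK // geq_minl.
have xk : val x = k.+1 by rewrite /= inordK.
have wf s : s \in insertion_family k ->
    [/\ uniq (ord0 :: s), 1 < size s, size s = k & x \notin ord0 :: s].
  move=> /(insertion_familyP (ltnW kn))[us sk vk _]; rewrite sk; split=> //.
  by apply/negP => /vk; rewrite xk ltnn.
have step c (S' : {set {set 'I_n.+1}}) :
    (forall s, s \in insertion_family k ->
      count (fun i => S \subset edge_set ord0 (insert_at x s i)) (iota (k.+1 - w) w) <=
      c * (S' \subset edge_set ord0 s)) ->
    extensions k.+1 S <= c * extensions k S'.
  move=> H; rewrite /extensions /= count_flatten -map_comp.
  apply: sumn_map_le_count => s /H /=; rewrite count_map; exact.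
have in_window s i : s \in insertion_family k -> i \in iota (k.+1 - w) w -> i <= size s.
  by move=> /wf[_ _ -> _]; rewrite mem_iota wk => /andP[_]; rewrite ltnS.
have win_size s : s \in insertion_family k ->
    k.+1 - w + w <= size (cycle_edges ord0 s).
  by move=> /wf[_ _ sk _]; rewrite size_cycle_edges sk wk.
have [/existsP[e /andP[eS xe]]|Sx] := boolP [exists e in S, x \in e].
  have exS : exists2 e, e \in S & x \in e by exists e.
  have [ext0|] := posnP (extensions k.+1 S); first by constructor 1.
  rewrite -has_count => /hasP[_ /allpairsP[[s i] /= [sF iw ->]] SE].
  have [us s1 _ xs] := wf _ sF.
  have [_ cardS _ /set0Pn[y yN]] := insert_at_contract us s1 xs (in_window _ _ sF iw) exS SE.
  constructor 3; exists (contract x S) => //; apply: step => {s i sF iw SE us s1 xs} s sF.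
  have [us s1 _ xs] := wf _ sF.
  have [/hasP[i iw SE]|] := boolP (has (fun i => S \subset edge_set ord0 (insert_at x s i))
    (iota (k.+1 - w) w)); last by rewrite has_count -eqn0Ngt => /eqP->.
  have [-> _ _ _] := insert_at_contract us s1 xs (in_window _ _ sF iw) exS SE.
  (* The split edge must contain the fixed neighbour [y] of the new vertex, and a cycle has at most
     two edges at [y]. *)
  rewrite muln1 (leq_trans _ (count_cycle_edges_mem y us)) //.
  apply: leq_trans (count_window set0 _ (win_size _ sF)).
  apply: sub_in_count => j jw SEj.
  have [_ _ /subsetP/(_ _ yN)] := insert_at_contract us s1 xs (in_window _ _ sF jw) exS SEj.
  by [].
have Sx' e : e \in S -> x \notin e.
  by move=> eS; apply: contra Sx => xe; apply/existsP; exists e; rewrite eS.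
constructor 2; apply: step => s sF.
have [us s1 sk xs] := wf _ sF.
have [/hasP[i iw SE]|] := boolP (has (fun i => S \subset edge_set ord0 (insert_at x s i))
  (iota (k.+1 - w) w)); last by rewrite has_count -eqn0Ngt => /eqP->.
have [SEs _] := insert_at_survive us s1 (in_window _ _ sF iw) Sx' SE.
rewrite SEs muln1 leq_min (leq_trans (count_size _ _)) ?size_iota //=.
apply: (@leq_trans (count (fun e => e \notin S) (cycle_edges ord0 s))).
  apply: leq_trans (count_window set0 _ (win_size _ sF)).
  apply: sub_in_count => j jw SEj.
  by have [_] := insert_at_survive us s1 (in_window _ _ sF jw) Sx' SEj.
have Sg : #|S| <= count (mem S) (cycle_edges ord0 s).
  rewrite -size_filter; apply: leq_trans (card_size _).
  apply: subset_leq_card; apply/subsetP => e eS.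
  by rewrite mem_filter /= eS; have := subsetP SEs e eS; rewrite inE.
have := count_predC (mem S) (cycle_edges ord0 s); rewrite size_cycle_edges sk => <-.
by rewrite -[leqLHS](addKn (count (mem S) (cycle_edges ord0 s))) leq_sub2l.
Qed.

End InsertionFamily.

Local Open Scope ring_scope.

Section Spread.
Variables (R : realType) (n m : nat).
Hypothesis (m2 : (2 <= m)%N).
Implicit Types (S : {set {set 'I_n.+1}}).

Local Notation fam := (insertion_family n m).
Local Notation ext := (@extensions n m).

Lemma size_insertion_family_fact k : (k <= m)%N -> size (fam k) = k`!.
Proof.
by elim: k => // k IH km; rewrite size_insertion_family (minn_idPl km) IH ?factS 1?ltnW.
Qed.

Lemma size_insertion_family_gt0 k : (0 < size (fam k))%N.
Proof.
elim: k => // k IH; rewrite size_insertion_family muln_gt0 IH andbT.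
by rewrite leq_min /= ltnW.
Qed.

(** While [k <= m] every gap is allowed, and the two cases of [extensions_step] cost a factor
    [k.+1 - #|S|] or a factor 2 per contracted edge. The induction starts at 2, the least value
    accepted there. *)
Lemma extensions_small k S : (2 <= k <= m)%N -> (k <= n)%N ->
  (ext k S <= 2 ^ #|S| * (k - #|S|)`!)%N.
Proof.
elim: k S => [|k IH] S // /andP[]; rewrite leq_eqVlt => /orP[/eqP[<-]|k1].
  move=> _ _; apply: (leq_trans (count_size _ _)).
  rewrite size_insertion_family_fact //.
  rewrite -[(2`!)%N]/2%N; case: #|S| => [|[|s]] //.
  apply: (@leq_trans (2 ^ s.+2)%N); last by rewrite leq_pmulr ?fact_gt0.
  by rewrite expnS leq_pmulr // expn_gt0.
move=> km kn; have {}IH S' := IH S' (_ : (2 <= k <= m)%N) (ltnW kn).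
have k2m : (2 <= k <= m)%N by rewrite -ltnS k1 ltnW.
case: (@extensions_step n m k S k1 kn) => [-> //|H|[S' SE H]].
  apply: (leq_trans H); apply: (@leq_trans ((k.+1 - #|S|) * (2 ^ #|S| * (k - #|S|)`!))).
    by rewrite leq_mul ?geq_minr ?IH.
  have [Sk|Sk] := leqP #|S| k; last by have -> : (k.+1 - #|S| = 0)%N by apply/eqP; rewrite subn_eq0.
  by rewrite mulnCA subSn // factS.
apply: (leq_trans H); rewrite SE expnS -mulnA leq_mul2l /=.
by rewrite subSS IH.
Qed.

(** The falling factorial of [k] of length [s] is at least [(k / e) ^ s]. The induction rests on
    [(1 + 1/k) ^ s <= expR (s / k) <= expR 1]. *)
Lemma exp_le_ffact s k : (s <= k)%N ->
  (k ^ s * (k - s)`!)%:R <= expR 1 ^+ s * k`!%:R :> R.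
Proof.
elim: s k => [|s IH] [|k] // sk; rewrite ?subn0 ?mul1n ?mul1r //.
have {}IH := IH k sk.
have step : (k.+1 ^ s)%:R <= expR 1 * (k ^ s)%:R :> R.
  case: k sk {IH} => [|k] sk.
    by move: sk; rewrite ltnS leqn0 => /eqP->; rewrite mulr1 (le_trans _ (expR_ge1Dx 1)) // lerDl.
  have k0 : 0 < k.+1%:R :> R by rewrite ltr0n.
  have -> : k.+2 = (k.+1 + 1)%N by rewrite addn1.
  rewrite !natrX natrD.
  have -> : k.+1%:R + 1 = k.+1%:R * (1 + k.+1%:R^-1) :> R by field; lra.
  rewrite exprMn mulrC ler_wpM2r ?exprn_ge0 ?ler0n //.
  apply: (@le_trans _ _ (expR k.+1%:R^-1 ^+ s)).
    by rewrite lerXn2r ?nnegrE ?expR_ge0 ?expR_ge1Dx // addr_ge0 // invr_ge0 ltW.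
  by rewrite -expRM_natl ler_expR ler_pdivrMr // mul1r ler_nat.
rewrite subSS expnS factS exprS !natrM in IH *.
apply: (@le_trans _ _ (k.+1%:R * (expR 1 * ((k ^ s)%:R * (k - s)`!%:R)))).
  by rewrite -mulrA ler_wpM2l // mulrA ler_wpM2r.
have -> : expR 1 * expR 1 ^+ s * (k.+1%:R * k`!%:R) =
  k.+1%:R * (expR 1 * (expR 1 ^+ s * k`!%:R)) :> R by ring.
by rewrite !ler_wpM2l ?expR_ge0.
Qed.

(** Per edge: a factor 2 for contraction, [expR 1] from the falling factorial, and a spare 2 used
    when [S] is a whole cycle. *)
Let A : R := 4 * expR 1.

(** At [k = m] this comes from [extensions_small]. Each later insertion multiplies the family size
    by [m], while the extensions gain a factor of at most [m], or at most [2 <= A] at the loss of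
    one edge. *)
Lemma extensions_spread k S : (m <= k <= n)%N ->
  (ext k S)%:R <= (A / m%:R) ^+ #|S| * (size (fam k))%:R.
Proof.
have m0 : 0 < m%:R :> R by rewrite ltr0n ltnW.
have e1 : 2 <= expR 1 :> R by have := expR_ge1Dx (1 : R); lra.
have A0 : 0 < A by rewrite /A; lra.
have q0 : 0 <= A / m%:R by rewrite divr_ge0 // ltW.
elim: k S => [|k IH] S; first by rewrite leqNgt ltnW.
rewrite leq_eqVlt => /andP[/orP[/eqP mE|mk] kn].
  have [->|ext0] := posnP (ext k.+1 S); first by rewrite mulr_ge0 ?exprn_ge0.
  have Sm := extensions_card kn ext0.
  have H : (ext k.+1 S <= 2 ^ #|S| * (k.+1 - #|S|)`!)%N.
    by apply: extensions_small kn; rewrite -mE; apply/andP; split.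
  apply: (le_trans (_ : _ <= (2 ^ #|S| * (k.+1 - #|S|)`!)%:R)); first by rewrite ler_nat.
  rewrite size_insertion_family_fact -mE // expr_div_n mulrAC ler_pdivlMr ?exprn_gt0 //.
  rewrite -mE in Sm.
  (* A set of [m.+1] edges is a whole cycle, out of reach of [exp_le_ffact]; the spare [2 ^+ m.+1]
     absorbs the missing factor [m]. *)
  move: Sm; rewrite leq_eqVlt => /orP[/eqP SE|]; last rewrite ltnS => Sm.
    rewrite SE subnS subnn fact0 muln1.
    have := exp_le_ffact (leqnn m); rewrite subnn muln1 natrX => Hm.
    have m_le : m%:R <= 2 ^+ m.+1 :> R.
      by rewrite -natrX ler_nat ltnW // ltnW // ltn_expl.
    have -> : A ^+ m.+1 = 2 ^+ m.+1 * (2 ^+ m.+1 * expR 1 ^+ m.+1).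
      by rewrite -!exprMn; congr (_ ^+ _); rewrite /A; lra.
    rewrite natrX [m%:R ^+ m.+1]exprSr -!mulrA ler_wpM2l ?exprn_ge0 //.
    rewrite [leLHS]mulrC; apply: ler_pM; rewrite ?exprn_ge0 //.
    apply: (le_trans Hm); rewrite ler_wpM2r // exprS ler_peMl ?exprn_ge0 ?expR_ge0 //.
    by apply: le_trans e1; rewrite ler1n.
  have := exp_le_ffact Sm; rewrite natrM => Hm.
  rewrite natrM mulrAC -mulrA natrX /A exprMn -mulrA.
  apply: ler_pM; rewrite ?exprn_ge0 ?mulr_ge0 ?exprn_ge0 //; last by rewrite natrX in Hm.
  by rewrite lerXn2r ?nnegrE // ler_nat.
have mk' : (m <= k <= n)%N by rewrite -ltnS mk ltnW.
have k2 : (1 < k)%N by rewrite (leq_trans m2) //; case/andP: mk'.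
rewrite size_insertion_family (minn_idPr _) ?natrM; last by apply: ltnW.
have [->|H|[S' SE H]] := @extensions_step n m k S k2 kn.
- by rewrite mulr_ge0 ?exprn_ge0 // mulr_ge0.
- rewrite mulrCA; apply: (le_trans (_ : _ <= m%:R * (ext k S)%:R)).
    rewrite -natrM ler_nat (leq_trans H) // leq_mul2r.
    by rewrite (leq_trans (geq_minl _ _)) ?orbT // geq_minr.
  by rewrite ler_wpM2l ?IH // ltW.
- apply: (le_trans (_ : _ <= 2 * (ext k S')%:R)); first by rewrite -natrM ler_nat.
  rewrite SE exprS [leRHS](_ : _ = A * ((A / m%:R) ^+ #|S'| * (size (fam k))%:R)).
    by apply: ler_pM => //; [rewrite /A; lra|exact: IH].
  by rewrite mulrACA divfK ?gt_eqF.
Qed.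

End Spread.

(** * Random sets and spread families *)

Section RandomSubset.
Variables (R : realType) (T : finType) (E : {set T}).
Implicit Types (p q r : R) (W Z A : {set T}).

(** Elements outside [E] get density 0, so that sums range over all sets and [bigA_distr] factors
    them. *)
Definition rset_weight p W : R :=
  \prod_e (if e \in W then (e \in E)%:R * p else 1 - (e \in E)%:R * p).

Definition rset_mean p (f : {set T} -> R) : R :=
  \sum_W rset_weight p W * f W.

Lemma rset_weight_ge0 p W : 0 <= p <= 1 -> 0 <= rset_weight p W.
Proof.
move=> /andP[p0 p1]; apply: prodr_ge0 => e _.
by case: (e \in E); case: ifP; rewrite ?mul1r ?mul0r ?subr0 ?subr_ge0.
Qed.

Lemma rset_mean_supset p A :
  A \subset E -> rset_mean p (fun W => (A \subset W)%:R) = p ^+ #|A|.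
Proof.
move=> AE.
(* [G] vanishes on [A], so expanding the product leaves only the supersets of [A]; outside [A] each
   factor is 1. *)
pose G e := if e \in A then 0 else 1 - (e \in E)%:R * p.
have -> : p ^+ #|A| = \prod_e ((e \in E)%:R * p + G e).
  rewrite (bigID (mem A)) /= [X in _ * X]big1 ?mulr1 => [|e eA]; last first.
    by rewrite /G (negbTE eA) addrC subrK.
  rewrite -prodr_const; apply: eq_bigr => e eA.
  by rewrite /G eA addr0 (subsetP AE) // mul1r.
rewrite bigA_distr; apply: eq_bigr => W _.
have [/subsetP AW|/subsetPn[e eA eW]] := boolP (A \subset W).
  rewrite mulr1; apply: eq_bigr => e _; case: ifP => // eW.
  by rewrite /G ifN //; apply: contraFN eW; exact: AW.
by rewrite mulr0 (bigD1 e) //= (negbTE eW) /G eA mul0r.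
Qed.

Lemma rset_mean1 p : rset_mean p (fun=> 1) = 1.
Proof.
rewrite -[RHS](expr0 p) -(cards0 T) -rset_mean_supset ?sub0set //.
by apply: eq_bigr => W _; rewrite sub0set.
Qed.

Lemma rset_mean_ge0 p f :
  0 <= p <= 1 -> (forall W, 0 <= f W) -> 0 <= rset_mean p f.
Proof. by move=> p01 f0; apply: sumr_ge0 => W _; rewrite mulr_ge0 ?rset_weight_ge0. Qed.

Lemma ler_rset_mean p f g :
  0 <= p <= 1 -> (forall W, f W <= g W) -> rset_mean p f <= rset_mean p g.
Proof. by move=> p01 fg; apply: ler_sum => W _; rewrite ler_wpM2l ?rset_weight_ge0. Qed.

Lemma rset_meanD p f g :
  rset_mean p (fun W => f W + g W) = rset_mean p f + rset_mean p g.
Proof. by rewrite -big_split; apply: eq_bigr => W _; rewrite mulrDr. Qed.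

Lemma rset_mean_cst p c : rset_mean p (fun=> c) = c.
Proof.
rewrite -[RHS]mul1r -(rset_mean1 p) mulr_suml.
by apply: eq_bigr => W _; rewrite mulr1.
Qed.

Lemma rset_weight_setU r1 r2 Z :
  \sum_W1 \sum_W2 rset_weight r1 W1 * rset_weight r2 W2 * (W1 :|: W2 == Z)%:R =
  rset_weight (1 - (1 - r1) * (1 - r2)) Z.
Proof.
pose c1 e : R := (e \in E)%:R * r1; pose c2 e : R := (e \in E)%:R * r2.
pose z e : R := (e \in Z)%:R.
(* Each factor lists the outcomes for [e]: in [W1], only in [W2], in neither; [z e] enforces
   agreement with [Z]. *)
transitivity (\prod_e (c1 e * z e + (1 - c1 e) * (c2 e * z e + (1 - c2 e) * (1 - z e)))).
  rewrite bigA_distr; apply: eq_bigr => W1 _.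
  transitivity (\prod_e ((if e \in W1 then c1 e * z e * c2 e else (1 - c1 e) * (c2 e * z e))
    + (if e \in W1 then c1 e * z e * (1 - c2 e) else (1 - c1 e) * ((1 - c2 e) * (1 - z e)))));
    last first.
    by apply: eq_bigr => e _; case: ifP => _; ring.
  rewrite bigA_distr; apply: eq_bigr => W2 _.
  rewrite /rset_weight -big_split /=.
  have -> : (W1 :|: W2 == Z)%:R = \prod_e ((e \in W1) || (e \in W2) == (e \in Z))%:R :> R.
    case: (eqVneq _ Z) => [<-|]; first by rewrite big1 // => e _; rewrite inE eqxx.
    rewrite eqEsubset negb_and => H.
    suff [e He] : exists e, ((e \in W1) || (e \in W2)) != (e \in Z).
      by rewrite (bigD1 e) //= (negbTE He) mul0r.
    case/orP: H => /subsetPn[e]; rewrite ?inE => h1 h2; exists e.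
      by rewrite h1 (negbTE h2).
    by rewrite h1 (negbTE h2).
  rewrite -big_split; apply: eq_bigr => e _ /=; rewrite -/(c1 e) -/(c2 e) /z.
  by case: (e \in W1); case: (e \in W2); case: (e \in Z) => /=; ring.
apply: eq_bigr => e _; rewrite /c1 /c2 /z.
by case: (e \in E); case: (e \in Z) => /=; ring.
Qed.

(* The union of independent random sets of densities r1 and r2 is random of
   density 1 - (1 - r1)(1 - r2). *)
Lemma rset_mean_setU r1 r2 f :
  rset_mean (1 - (1 - r1) * (1 - r2)) f =
  rset_mean r1 (fun W1 => rset_mean r2 (fun W2 => f (W1 :|: W2))).
Proof.
rewrite /rset_mean.
transitivity (\sum_W1 \sum_W2 \sum_Z
   rset_weight r1 W1 * rset_weight r2 W2 * (W1 :|: W2 == Z)%:R * f Z).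
  under eq_bigr do rewrite -rset_weight_setU mulr_suml.
  rewrite exchange_big; apply: eq_bigr => W1 _ /=.
  rewrite exchange_big; apply: eq_bigr => Z _ /=.
  by rewrite mulr_suml.
apply: eq_bigr => W1 _; rewrite mulr_sumr; apply: eq_bigr => W2 _.
rewrite (bigD1 (W1 :|: W2)) //= eqxx big1 ?addr0 ?mulr1 ?mulrA // => Z ZN.
by rewrite eq_sym (negbTE ZN) mulr0 mul0r.
Qed.

(** An element of [A] contributes [(1 - r) * r] on the left and [r] on the right; the other factors
    agree. *)
Lemma rset_weight_setD r Z A : 0 <= r <= 1 -> A \subset Z -> A \subset E ->
  rset_weight r (Z :\: A) * r ^+ #|A| <= rset_weight r Z.
Proof.
move=> r01 AZ AE; have /andP[r0 r1] := r01.
have -> : r ^+ #|A| = \prod_e (if e \in A then r else 1).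
  by rewrite -big_mkcond prodr_const.
rewrite -big_split; apply: ler_prod => e _ /=; rewrite inE.
have [eA|eA] /= := boolP (e \in A).
  rewrite (subsetP AZ) // (subsetP AE) // mul1r.
  by rewrite mulr_ge0 ?subr_ge0 //= ler_piMl // lerBlDr lerDl.
case: ifP => _; rewrite mulr1 lexx andbT.
  by rewrite mulr_ge0.
by case: (e \in E); rewrite ?mul1r ?mul0r ?subr_ge0.
Qed.

End RandomSubset.

(** * Minimal fragments and the failure probability of a spread family *)

Section Fragments.
Variables (R : realType) (T : finType) (E : {set T}).
Implicit Types (p q r : R) (W Z A B S : {set T}) (F U : {set {set T}}).

Definition contains_member F W : bool := [exists S in F, S \subset W].

Definition rset_fail p F : R :=
  rset_mean E p (fun W => (~~ contains_member F W)%:R).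

Definition fragments F W : {set {set T}} :=
  [set A | minset (mem [set S :\: W | S in F]) A].

Lemma fragmentsP F W A : A \in fragments F W ->
  (exists2 S, S \in F & A = S :\: W) /\
  (forall S, S \in F -> S :\: W \subset A -> S :\: W = A).
Proof.
rewrite inE => /minsetP[/imsetP[S SF ->] Amin]; split; first by exists S.
by move=> S' S'F; apply: Amin; apply: imset_f.
Qed.

Lemma fragments_cover F W S : S \in F ->
  exists2 A, A \in fragments F W & A \subset S.
Proof.
move=> SF; have SWF : mem [set B :\: W | B in F] (S :\: W) by apply: imset_f.
have [A Amin AS] := minset_exists SWF.
by exists A; rewrite ?inE // (subset_trans AS) ?subsetDl.
Qed.

Lemma fragments_fail F W1 W2 F' :
  F' \subset fragments F W1 -> contains_member F' W2 -> contains_member F (W1 :|: W2).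
Proof.
move=> F'sub /existsP[A /andP[AF' AW2]]; apply/existsP.
have [[S SF AE] _] := fragmentsP (subsetP F'sub _ AF').
by exists S; rewrite SF /= -subDset -AE.
Qed.

(* For a fragment A of W put Z := W :|: A and fix a member S of F inside Z that
   depends only on Z: by minimality A = S :\: W, so that, given Z, there are at
   most 2 ^ #|S| choices for A. *)
Lemma fragments_cost q r k F : 0 <= q -> q <= r -> 0 < r -> r <= 1 ->
  (forall S, S \in F -> S \subset E /\ (#|S| < 2 * k)%N) ->
  rset_mean E r (fun W => \sum_(A in fragments F W | (k <= #|A|)%N) q ^+ #|A|) <=
  (4 * q / r) ^+ k.
Proof.
move=> q0 qr r0 r1 Fk; have r01 : 0 <= r <= 1 by rewrite ltW.
(* The default [set0] is harmless: [W :|: A] contains a member of [F] whenever [A] is a fragment of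
   [W]. *)
pose member Z := odflt set0 [pick S in F | S \subset Z].
have memberP W A : A \in fragments F W -> A \subset member (W :|: A).
  move=> /fragmentsP[[S SF AE] Amin]; rewrite /member; case: pickP => [S'|/(_ S)] /=.
    move=> /andP[S'F S'Z]; rewrite -(Amin S') ?subsetDl //.
    by rewrite subDset.
  by rewrite SF /= AE -subDset subxx.
have member_card Z : (#|member Z| <= 2 * k)%N.
  rewrite /member; case: pickP => [S /andP[SF _]|_] /=; last by rewrite cards0.
  by rewrite ltnW //; case: (Fk S SF).
have frag_disj W A : A \in fragments F W -> (W :|: A) :\: A = W.
  move=> /fragmentsP[[S SF ->] _]; apply/setP => x; rewrite !inE.
  by case: (x \in W); case: (x \in S).
have fragE W A : A \in fragments F W -> A \subset E.
  move=> /fragmentsP[[S SF ->] _].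
  by rewrite (subset_trans (subsetDl _ _)) //; case: (Fk S SF).
rewrite /rset_mean.
under eq_bigr do rewrite mulr_sumr.
rewrite (exchange_big_dep (fun A => (k <= #|A|)%N)) /=; last by move=> W A _ /andP[].
have bound A : (k <= #|A|)%N ->
    \sum_(W | (A \in fragments F W) && (k <= #|A|)%N) rset_weight E r W * q ^+ #|A| <=
    \sum_(Z | A \subset member Z) rset_weight E r Z * (q / r) ^+ k.
  move=> kA.
  (* As [A] is disjoint from [W], the set [W] is recovered from [Z]. Trading the weight of [W] for
     that of [Z] costs [r ^- #|A|], which leaves [(q / r) ^+ #|A|]. *)
  rewrite (reindex_onto (fun Z => Z :\: A) (fun W => W :|: A)) /=; last first.
    by move=> W /andP[+ _]; exact: frag_disj.
  rewrite big_mkcond [leRHS]big_mkcond; apply: ler_sum => Z _.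
  case: ifP => [/andP[/andP[AF _] /eqP ZE]|_]; last first.
    by case: ifP => // _; rewrite mulr_ge0 ?rset_weight_ge0 ?exprn_ge0 ?divr_ge0 // ltW.
  have := memberP _ _ AF; rewrite ZE => ->.
  have AZ : A \subset Z by rewrite -ZE subsetUr.
  have AE := fragE _ _ AF.
  apply: (@le_trans _ _ (rset_weight E r Z * (q / r) ^+ #|A|)).
    rewrite expr_div_n mulrCA mulrC ler_wpM2l ?exprn_ge0 //.
    by rewrite ler_pdivlMr ?exprn_gt0 // rset_weight_setD.
  rewrite ler_wpM2l ?rset_weight_ge0 // ler_wiXn2l ?divr_ge0 //; first exact: ltW.
  by rewrite ler_pdivrMr ?mul1r.
apply: (le_trans (ler_sum _ bound)).
rewrite (exchange_big_dep predT) //=.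
have -> : (4 * q / r) ^+ k = \sum_Z rset_weight E r Z * (4 * q / r) ^+ k.
  by rewrite -mulr_suml; have := rset_mean1 E r; rewrite /rset_mean;
    under eq_bigr do rewrite mulr1; move=> ->; rewrite mul1r.
apply: ler_sum => Z _; rewrite sumr_const -mulrnAr ler_wpM2l ?rset_weight_ge0 //.
rewrite -mulrA [in leRHS]exprMn -[leLHS]mulr_natl ler_wpM2r //.
  by rewrite exprn_ge0 ?divr_ge0 // ltW.
rewrite -[4]/((2 ^ 2)%:R) -natrX ler_nat -expnM.
apply: (@leq_trans #|powerset (member Z)|).
  by apply: subset_leq_card; apply/subsetP => A; rewrite !inE => /andP[].
by rewrite card_powerset leq_exp2l.
Qed.

(* [lam] stands for the fraction of the members of a fixed q-spread family that
   contain a member of the argument.  In each round the fragments of size at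
   least 2 ^ j are discarded at an expected cost of (4 q / r_j) ^ (2 ^ j). *)
Lemma rset_fail_spread q (lam : {set {set T}} -> R) (r : nat -> R) :
  0 <= q -> (forall j, 0 < r j) -> (forall j, q <= r j) ->
  lam set0 <= 0 -> (forall F, lam F <= 1) ->
  (forall F F' U,
     (forall S, S \in F -> exists2 A, A \in F' :|: U & A \subset S) ->
     lam F <= lam F' + \sum_(A in U) q ^+ #|A|) ->
  forall J F p,
    (forall S, S \in F -> S \subset E /\ (#|S| < 2 ^ J)%N) ->
    \sum_(j < J) r j <= p -> p <= 1 ->
    rset_fail p F + lam F <= 1 + \sum_(j < J) (4 * q / r j) ^+ (2 ^ j).
Proof.
move=> q0 r0 qr lam0 lam1 lamU; elim=> [|J IH] F p FJ.
  rewrite !big_ord0 addr0 => p0 p1; have p01 : 0 <= p <= 1 by rewrite p0.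
  (* Members have size below [2 ^ 0], so either [F] is empty and [lam F <= 0], or [set0] is in [F]
     and no set fails. *)
  have [->|[S SF]] := set_0Vmem F.
    rewrite -[leRHS]addr0 lerD //.
    rewrite -(rset_mean_cst E p 1) ler_rset_mean // => W.
    by case: contains_member.
  have S0 : S = set0 by apply/eqP; rewrite -cards_eq0; case: (FJ S SF); case: #|S|.
  rewrite /rset_fail -[leRHS]add0r lerD // -(rset_mean_cst E p 0).
  apply: ler_rset_mean => // W.
  suff -> : contains_member F W by [].
  by apply/existsP; exists S; rewrite SF S0 sub0set.
rewrite !big_ord_recr /= => rp p1.
set s := \sum_(j < J) r j in rp; have s0 : 0 <= s by apply: sumr_ge0 => j _; exact: ltW.
have rJ0 := r0 J; have rJ1 : r J <= 1 by lra.
have p01 : 0 <= p <= 1 by apply/andP; split; lra.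
have rJ01 : 0 <= r J <= 1 by apply/andP; split; lra.
(* The density left for the later rounds once a random set of density [r J] is exposed; rounds run
   from large indices down to 0. *)
pose p' := (p - r J) / (1 - r J).
have [pE sp' p'1] : [/\ p = 1 - (1 - r J) * (1 - p'), s <= p' & p' <= 1].
  rewrite /p'; have [rJ|rJ] := eqVneq (r J) 1.
    (* Division by zero gives [p' = 0], while [s + r J <= p <= 1] forces [p = 1] and [s = 0]. *)
    by rewrite rJ subrr invr0 mulr0; split => //; lra.
  have rJlt : 0 < 1 - r J by rewrite subr_gt0 lt_neqAle rJ.
  split.
  - by field; lra.
  - by rewrite ler_pdivlMr //; nra.
  - by rewrite ler_pdivrMr //; lra.
have p'01 : 0 <= p' <= 1 by apply/andP; split; lra.
pose F' W := [set A in fragments F W | (#|A| < 2 ^ J)%N].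
pose U W := [set A in fragments F W | (2 ^ J <= #|A|)%N].
have F'E W : forall A, A \in F' W -> A \subset E /\ (#|A| < 2 ^ J)%N.
  move=> A; rewrite inE => /andP[/fragmentsP[[S SF ->] _] ->]; split=> //.
  by rewrite (subset_trans (subsetDl _ _)) //; case: (FJ S SF).
set d := \sum_(j < J) _.
(* Given [W], failure of [F] implies failure of the small fragments [F' W]; discarding the large
   ones [U W] lowers [lam] by at most their cost. *)
have fail_le W : rset_mean E p' (fun W2 => (~~ contains_member F (W :|: W2))%:R) <=
    (1 + d - lam F) + \sum_(A in U W) q ^+ #|A|.
  have lamF : lam F <= lam (F' W) + \sum_(A in U W) q ^+ #|A|.
    apply: lamU => S SF; have [A AF AS] := fragments_cover W SF.
    by exists A; rewrite // !inE; rewrite inE in AF; rewrite AF /= ltnNge orNb.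
  have failF : rset_fail p' (F' W) + lam (F' W) <= 1 + d by apply: (IH _ _ (F'E W) sp').
  suff : rset_mean E p' (fun W2 => (~~ contains_member F (W :|: W2))%:R) <=
    rset_fail p' (F' W) by lra.
  apply: ler_rset_mean => // W2; rewrite ler_nat.
  case: (boolP (contains_member (F' W) W2)) => [cF|_]; last by case: contains_member.
  have F'sub : F' W \subset fragments F W.
    by apply/subsetP => A; rewrite inE => /andP[].
  by rewrite (fragments_fail F'sub cF).
have cost : rset_mean E (r J) (fun W => \sum_(A in U W) q ^+ #|A|) <=
    (4 * q / r J) ^+ (2 ^ J).
  have := @fragments_cost q (r J) (2 ^ J) F q0 (qr J) rJ0 rJ1.
  rewrite -expnS => /(_ FJ); apply: le_trans.
  apply: ler_rset_mean => // W; rewrite le_eqVlt; apply/orP; left; apply/eqP.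
  by apply: eq_bigl => A; rewrite !inE.
rewrite /rset_fail pE rset_mean_setU.
have := ler_rset_mean E rJ01 fail_le.
rewrite rset_meanD rset_mean_cst; lra.
Qed.

End Fragments.

(** * Hamilton cycles in the random graph *)

(** In [rset_fail_spread], [lam F] is taken to be the fraction of listed cycles containing a member
    of [F]. The full family has [lam = 1], which cancels the 1 on the right. *)
Lemma insertion_family_fail (R : realType) n m (E : {set {set 'I_n.+1}}) p J (r : nat -> R) :
  E = edge_slots n.+1 -> (2 <= m <= n)%N -> (n.+1 < 2 ^ J)%N ->
  (forall j, 4 * expR 1 / m%:R <= r j) -> \sum_(j < J) r j <= p -> p <= 1 ->
  rset_fail E p [set S in map (edge_set ord0) (insertion_family n m n)] <=
    \sum_(j < J) (4 * (4 * expR 1 / m%:R) / r j) ^+ (2 ^ j).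
Proof.
move=> EE /andP[m2 mn] nJ qr rp p1.
set q := 4 * expR 1 / m%:R in qr *; set fam := insertion_family n m n.
have q0 : 0 < q by rewrite divr_gt0 ?mulr_gt0 ?expR_gt0 // ltr0n ltnW.
have r0 j : 0 < r j by apply: lt_le_trans q0 _.
have fam0 : 0 < (size fam)%:R :> R by rewrite ltr0n size_insertion_family_gt0.
pose lam F : R :=
  (count (fun s => contains_member F (edge_set ord0 s)) fam)%:R / (size fam)%:R.
have spread (A : {set {set 'I_n.+1}}) :
    (count (fun s => A \subset edge_set ord0 s) fam)%:R / (size fam)%:R <= q ^+ #|A|.
  rewrite ler_pdivrMr //; apply: (@extensions_spread R n m m2 n A).
  by rewrite mn leqnn.
set F0 := [set S in _].
have lamF0 : lam F0 = 1.
  rewrite /lam (eq_in_count (a2 := predT)) ?count_predT ?divff ?gt_eqF //.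
  move=> s sF; apply/existsP; exists (edge_set ord0 s).
  by rewrite subxx andbT inE; apply: map_f.
have := @rset_fail_spread R _ E q lam r (ltW q0) r0 qr.
rewrite -[X in _ -> _ <= X]add0r => H.
have := H _ _ _ J F0 p _ rp p1; rewrite lamF0 add0r addrC lerD2l; apply.
- rewrite /lam (eq_in_count (a2 := pred0)) ?count_pred0 ?mul0r // => s sF.
  by apply/existsP => -[A]; rewrite inE.
- by move=> F; rewrite ler_pdivrMr // mul1r ler_nat count_size.
(* A cycle containing a member of [F] contains one of [F'] or of [U]; spread bounds the fraction of
   cycles containing a given [A]. *)
- move=> F F' U FU; rewrite -lerBlDl.
  apply: le_trans (ler_sum _ (fun A _ => spread A)).
  rewrite lerBlDl /lam -mulr_suml -mulrDl ler_pM2r ?invr_gt0 //.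
  rewrite -natr_sum -natrD ler_nat; move: (fam) => l; elim: l => [|s l IH] //=.
  rewrite big_split /= addnACA leq_add // {IH}.
  case: (boolP (contains_member F _)) => // /existsP[S /andP[SF Ss]].
  have [A + AS] := FU S SF; rewrite inE => /orP[AF'|AU].
    rewrite (_ : contains_member F' _) //; apply/existsP.
    by exists A; rewrite AF' (subset_trans AS).
  by rewrite (bigD1 A) //= (subset_trans AS Ss) addnA addnAC leq_addl.
- move=> S; rewrite inE => /mapP[s sF ->].
  have [us sn _ _] := insertion_familyP (leqnn n) sF.
  rewrite EE; split.
    apply/subsetP => e; rewrite !inE => es; apply/eqP.
    by apply: card_cycle_edge us _ es; rewrite sn (leq_trans _ mn) // ltnW.
  by rewrite (leq_ltn_trans _ nJ) // cardsE (leq_trans (card_size _)) // size_cycle_edges sn.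
Qed.

Lemma path_adjE n (G : {set {set 'I_n}}) x s :
  path (adj G) x s = all (mem G) (path_edges x s).
Proof. by elim: s x => //= y s IH x; rewrite IH. Qed.

Lemma cycle_adjE n (G : {set {set 'I_n}}) h s :
  cycle (adj G) (h :: s) = (edge_set h s \subset G).
Proof.
rewrite /= path_adjE; apply/allP/subsetP => H e; first by rewrite inE; exact: H.
by move=> es; apply: H; rewrite inE.
Qed.

Lemma Gnp_probE (R : realType) n (p : R) (P : pred {set {set 'I_n}}) :
  Gnp_prob p P = rset_mean (edge_slots n) p (fun G => (P G)%:R).
Proof.
rewrite /Gnp_prob /rset_mean big_mkcond /=; apply: eq_bigr => G _.
rewrite inE; case: (boolP (G \subset _)) => [GE|/subsetPn[e eG eE]] /=; last first.
  by rewrite /rset_weight (bigD1 e) //= eG (negbTE eE) mul0r !mul0r.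
case: (P G); rewrite ?mulr0 ?mulr1 // /rset_weight [RHS](bigID (mem (edge_slots n))) /=.
rewrite [X in _ * X]big1 ?mulr1 => [|e eE]; last first.
  by rewrite (negbTE eE) mul0r subr0 ifN //; apply: contra eE => /(subsetP GE).
by apply: eq_bigr => e ->; rewrite !mul1r.
Qed.

Lemma Gnp_probC (R : realType) n (p : R) (P : pred {set {set 'I_n}}) :
  Gnp_prob p P = 1 - Gnp_prob p (fun G => ~~ P G).
Proof.
rewrite !Gnp_probE; apply: (canRL (addrK _)).
rewrite -rset_meanD -[RHS](rset_mean1 (edge_slots n) p).
by apply: eq_bigr => G _; case: (P G); rewrite /= ?addr0 ?add0r.
Qed.

Lemma insertion_family_hamilton (R : realType) n m (M : R) (G : {set {set 'I_n.+1}}) :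
  (2 <= n)%N -> (n * m)%:R <= M ->
  contains_member [set S in map (edge_set ord0) (insertion_family n m n)] G ->
  has_hamilton_cycle_le M G.
Proof.
move=> n2 nmM /existsP[S /andP[+ SG]]; rewrite inE => /mapP[s sF SE].
have [us sn _ inv] := insertion_familyP (leqnn n) sF.
have sz : size (ord0 :: s) == n.+1 by rewrite /= sn.
apply/existsP; exists (Tuple sz); rewrite inversionsE.
rewrite (le_trans _ nmM) ?ler_nat // andbT /hamilton_cycle ltnS n2 /=.
by rewrite /ucycleb us andbT cycle_adjE -SE.
Qed.

(** * Choice of the densities of the rounds *)

Lemma sum_indicator_lt J j0 : (\sum_(j < J) (j < j0) <= j0)%N.
Proof.
suff -> : (\sum_(j < J) (j < j0) = minn J j0)%N by exact: geq_minr.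
elim: J => [|J IH]; first by rewrite big_ord0 min0n.
by rewrite big_ord_recr /= IH; case: (ssrnat.ltnP J j0) => h /=; lia.
Qed.

Lemma geometric_tail (R : realFieldType) J j0 :
  \sum_(j < J) (j0 <= j)%N%:R * 2^-1 ^+ j <= 2 * 2^-1 ^+ j0 :> R.
Proof.
(* Carrying the remaining tail along makes the induction on [J] telescope. *)
suff : \sum_(j < J) (j0 <= j)%N%:R * 2^-1 ^+ j + 2 * 2^-1 ^+ maxn J j0 <= 2 * 2^-1 ^+ j0 :> R.
  by apply: le_trans; rewrite lerDl mulr_ge0 // exprn_ge0 // invr_ge0.
elim: J => [|J IH]; first by rewrite big_ord0 add0r max0n.
rewrite big_ord_recr /=; case: (boolP (j0 <= J)%N) IH => Jj0 /=.
  rewrite (maxn_idPl Jj0) (maxn_idPl (leqW Jj0)) exprS => IH.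
  by apply: le_trans IH; rewrite mul1r mulVKf ?pnatr_eq0 //; lra.
rewrite -ltnNge in Jj0; by rewrite mul0r addr0 (maxn_idPr (ltnW Jj0)) (maxn_idPr Jj0).
Qed.

(* The densities of the rounds, in units of the spread: constant except for a
   bounded number of final rounds, where a large constant makes the total
   failure probability small. *)
Lemma round_densities (R : realType) (eps : R) : 0 < eps ->
  exists L : R, exists2 a : nat -> R, forall j, 16 <= a j &
    forall J, \sum_(j < J) a j <= L + 16 * J%:R /\
      \sum_(j < J) (4 / a j) ^+ (2 ^ j) <= eps.
Proof.
move=> eps0.
have [j0 j0E] : exists j0, 2 * 2^-1 ^+ j0 <= eps / 2 :> R.
  have h1 : `|2^-1 : R| < 1 by rewrite ger0_norm ?invr_ge0 // invf_lt1 // ltr1n.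
  have e4 : 0 < eps / 4 by rewrite divr_gt0.
  have /cvgrPdist_le/(_ _ e4)[N _ /(_ N (leqnn N))] := cvg_expr h1.
  rewrite /= sub0r normrN ger0_norm ?exprn_ge0 ?invr_ge0 // => H.
  by exists N; lra.
(* Each index below [j0] will cost at most [B^-1], in total at most [eps / 2]; the added 1 keeps [B]
   positive when [j0 = 0]. *)
pose B : R := 2 * j0%:R / eps + 1.
have B0 : 0 <= 2 * j0%:R / eps by rewrite divr_ge0 ?mulr_ge0 // ltW.
have B1 : 1 <= B by rewrite /B lerDr.
pose a j : R := 16 + 4 * B * (j < j0)%N%:R.
have a16 j : 16 <= a j by rewrite /a lerDl mulr_ge0 // mulr_ge0 //; lra.
exists (4 * B * j0%:R); exists a => // J; split.
  rewrite big_split /= sumr_const card_ord -mulr_sumr -natr_sum addrC.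
  rewrite -[16 *+ J]mulr_natr lerD2r ler_wpM2l ?ler_nat ?sum_indicator_lt //; lra.
apply: (@le_trans _ _ (\sum_(j < J) (B^-1 * (j < j0)%N%:R + (j0 <= j)%N%:R * 2^-1 ^+ j))).
  apply: ler_sum => j _; have a0 : 0 < a j by apply: lt_le_trans (a16 j).
  case: (ssrnat.ltnP j j0) => jj0.
    rewrite mulr1 mul0r addr0; apply: (@le_trans _ _ (4 / a j)).
      rewrite -[leRHS]expr1 ler_wiXn2l ?expn_gt0 ?divr_ge0 // ?(ltW a0) //.
      by rewrite ler_pdivrMr // mul1r (le_trans _ (a16 j)) // ler_nat.
    rewrite ler_pdivrMr // ler_pdivlMl; last by lra.
    by rewrite /a jj0 mulr1; lra.
  (* Here [4 / a j <= 1/2], and [j <= 2 ^ j] leaves a geometric tail. *)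
  rewrite mulr0 add0r mul1r; apply: (@le_trans _ _ (2^-1 ^+ (2 ^ j))).
    rewrite lerXn2r ?nnegrE ?invr_ge0 ?divr_ge0 // ?(ltW a0) //.
    by rewrite ler_pdivrMr // ler_pdivlMl //; have := a16 j; lra.
  by rewrite ler_wiXn2l ?invr_ge0 ?invf_le1 ?ler1n // ltnW // ltn_expl.
rewrite big_split /= -mulr_sumr -natr_sum.
have := geometric_tail R J j0.
suff : B^-1 * (\sum_(j < J) (j < j0)%N)%N%:R <= eps / 2 by lra.
rewrite ler_pdivrMl; last by lra.
apply: (@le_trans _ _ j0%:R); first by rewrite ler_nat sum_indicator_lt.
rewrite /B mulrDl mul1r; have -> : 2 * j0%:R / eps * (eps / 2) = j0%:R by field; lra.
by rewrite lerDl divr_ge0 // ltW.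
Qed.

Lemma Gnp_prob_le1 (R : realType) n (p : R) (P : pred {set {set 'I_n}}) :
  0 <= p <= 1 -> Gnp_prob p P <= 1.
Proof.
move=> p01; rewrite Gnp_probE -[leRHS](rset_mean_cst (edge_slots n) p).
by apply: ler_rset_mean => // G; case: (P G).
Qed.

(** The rounds get densities [q * a j] for the spread [q], which then cancels in the failure
    bound. *)
Lemma hamilton_prob_ge (R : realType) n m (M p : R) J (a : nat -> R) :
  (2 <= m <= n)%N -> (n.+1 < 2 ^ J)%N -> (n * m)%:R <= M ->
  (forall j, 1 <= a j) -> 4 * expR 1 / m%:R * \sum_(j < J) a j <= p -> p <= 1 ->
  1 - \sum_(j < J) (4 / a j) ^+ (2 ^ j) <=
    Gnp_prob p (@has_hamilton_cycle_le R n.+1 M).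
Proof.
move=> mn nJ nmM a1 ap p1; have /andP[m2 _] := mn.
set q := 4 * expR 1 / m%:R in ap.
have q0 : 0 < q by rewrite divr_gt0 ?mulr_gt0 ?expR_gt0 // ltr0n ltnW.
rewrite mulr_sumr in ap.
have qr j : q <= q * a j by rewrite ler_peMr // ltW.
have p0 : 0 <= p.
  by apply: le_trans ap; apply: sumr_ge0 => j _; apply: le_trans (qr j); exact: ltW.
have := insertion_family_fail erefl mn nJ qr ap p1.
rewrite -/q => H; rewrite Gnp_probC lerD2l lerN2 Gnp_probE.
apply: (le_trans (_ : _ <= rset_fail (edge_slots n.+1) p _)).
  apply: ler_rset_mean; first by rewrite p0.
  move=> G; rewrite ler_nat.
  case: (boolP (contains_member _ G)) => [cF|_]; last by case: (has_hamilton_cycle_le _ _).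
  rewrite (insertion_family_hamilton _ nmM cF) //.
  by case/andP: mn => m2' /(leq_trans m2').
apply: (le_trans H); apply: ler_sum => j _; rewrite le_eqVlt; apply/orP; left; apply/eqP.
by congr (_ ^+ _); rewrite -mulrA mulrA; field; rewrite !gt_eqF // (lt_le_trans _ (a1 j)).
Qed.

(** * First moment: counting permutations with few inversions *)

Section FirstMoment.
Variables (R : realType) (n : nat).
Implicit Types c : n.+1.-tuple 'I_n.+1.

Let code c : {ffun 'I_n.+1 -> 'I_n.+1} :=
  [ffun i : 'I_n.+1 => inord (nth 0%N (lehmer (map val c)) i)].

Let nth_lehmer_lt c (i : 'I_n.+1) : (nth 0 (lehmer (map val c)) i < n.+1)%N.
Proof.
have /lehmer_bound/allP : size (map val c) = n.+1 by rewrite size_map size_tuple.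
by apply; apply: mem_nth; rewrite size_lehmer size_map size_tuple.
Qed.

Let sum_code c : (\sum_i code c i)%N = inversions c.
Proof.
rewrite inversionsE sumnE (big_nth 0%N) size_lehmer size_map size_tuple big_mkord.
by apply: eq_bigr => i _; rewrite ffunE inordK.
Qed.

Let code_inj : {in [set c : n.+1.-tuple 'I_n.+1 | uniq c] &, injective code}.
Proof.
have full c : uniq c -> c =i predT.
  move=> uc; apply/(subset_cardP _); last exact/subsetP.
  by rewrite (card_uniqP uc) size_tuple card_ord.
move=> c d; rewrite !inE => uc ud cd; apply: val_inj; apply: (inj_map val_inj).
apply: lehmer_inj.
- by apply/perm_map/uniq_perm => // i; rewrite (full c) // (full d).
- by rewrite map_inj_uniq //; exact: val_inj.
apply: (@eq_from_nth _ 0%N) => [|i]; first by rewrite !size_lehmer !size_map !size_tuple.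
rewrite size_lehmer size_map size_tuple => ilt.
have /(congr1 val) : code c (Ordinal ilt) = code d (Ordinal ilt) by rewrite cd.
by rewrite !ffunE /= !inordK //; [exact: (nth_lehmer_lt d (Ordinal ilt))|
  exact: (nth_lehmer_lt c (Ordinal ilt))].
Qed.

(** The Lehmer code is injective with entry sum the number of inversions. Enlarging its image to all
    functions makes the sum a product of geometric sums. *)
Lemma sum_uniq_expr_inversions (x : R) : 0 <= x ->
  \sum_(c : n.+1.-tuple 'I_n.+1 | uniq c) x ^+ inversions c <=
  (\sum_(k < n.+1) x ^+ k) ^+ n.+1.
Proof.
move=> x0.
have -> : (\sum_(k < n.+1) x ^+ k) ^+ n.+1 =
    \sum_(f : {ffun 'I_n.+1 -> 'I_n.+1}) x ^+ (\sum_i f i).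
  rewrite -[X in _ ^+ X](card_ord n.+1) -prodr_const.
  rewrite (bigA_distr_bigA (fun i (k : 'I_n.+1) => x ^+ k)) /=.
  by apply: eq_bigr => f _; rewrite expr_sum.
under eq_bigr do rewrite -sum_code.
rewrite (eq_bigl (fun c => c \in [set c : n.+1.-tuple 'I_n.+1 | uniq c]));
  last by move=> c; rewrite inE.
rewrite -(big_imset (fun f : {ffun 'I_n.+1 -> 'I_n.+1} => x ^+ (\sum_i f i)) code_inj).
by rewrite big_mkcond /=; apply: ler_sum => f _; case: ifP; rewrite ?exprn_ge0.
Qed.

Lemma count_few_inversions (M : R) : 0 < M ->
  (#|[set c : n.+1.-tuple 'I_n.+1 | uniq c && ((inversions c)%:R <= M)]|)%:R <=
  (expR 1 * (1 + M / n.+1%:R)) ^+ n.+1.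
Proof.
move=> M0; have n0 : 0 < n.+1%:R :> R by rewrite ltr0n.
(* With this [t], at most [M] inversions mean weight at least [expR (- n.+1)], compensated by
   [expR 1 ^+ n.+1]. *)
set t := n.+1%:R / M; have t0 : 0 < t by rewrite divr_gt0.
set x := expR (- t); have x0 : 0 <= x by rewrite expR_ge0.
have x1 : x < 1 by rewrite expR_lt1; lra.
have geo : \sum_(k < n.+1) x ^+ k <= 1 + M / n.+1%:R.
  have -> : M / n.+1%:R = t^-1 by rewrite invf_div.
  rewrite -(ler_pM2r (_ : 0 < 1 - x)) ?subr_gt0 //.
  have -> : (\sum_(k < n.+1) x ^+ k) * (1 - x) = 1 - x ^+ n.+1.
    by have := subrX1 x n.+1; rewrite mulrC; lra.
  apply: (@le_trans _ _ 1); first by rewrite lerBlDr lerDl exprn_ge0.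
  have xt : x * (1 + t) <= 1.
    apply: (@le_trans _ _ (x * expR t)); first by rewrite ler_wpM2l ?expR_ge1Dx.
    by rewrite /x -expRD addNr expR0.
  have -> : (1 + t^-1) * (1 - x) = 1 + t^-1 * (1 - x * (1 + t)) by field; lra.
  by rewrite lerDl mulr_ge0 ?invr_ge0 ?(ltW t0) // subr_ge0.
rewrite exprMn; apply: (@le_trans _ _ (expR 1 ^+ n.+1 * (\sum_(k < n.+1) x ^+ k) ^+ n.+1)).
  apply: le_trans (ler_wpM2l _ (sum_uniq_expr_inversions x0)); last by rewrite exprn_ge0 ?expR_ge0.
  rewrite -sum1_card natr_sum mulr_sumr big_mkcond [leRHS]big_mkcond /=.
  apply: ler_sum => c _; rewrite inE; case: (uniq c) => //=.
  have w0 : 0 <= expR 1 ^+ n.+1 * x ^+ inversions c by rewrite mulr_ge0 ?exprn_ge0 ?expR_ge0.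
  case: ifP => // cM; rewrite /x -!expRM_natl -expRD mulr1.
  rewrite -[1%:R]expR0 ler_expR mulrN subr_ge0.
  apply: (@le_trans _ _ (M * t)); first by rewrite ler_wpM2r // ltW.
  by rewrite /t mulrC divfK ?gt_eqF.
rewrite ler_wpM2l ?exprn_ge0 ?expR_ge0 // lerXn2r ?nnegrE //.
- by apply: sumr_ge0 => k _; rewrite exprn_ge0.
- by rewrite addr_ge0 // divr_ge0 // ltW.
Qed.

(** Union bound over [D]: each sequence has [n.+1] distinct cycle edges, all present with
    probability [p ^+ n.+1]. *)
Lemma hamilton_prob_le (M p : R) : (2 <= n)%N -> 0 < M -> 0 <= p <= 1 ->
  Gnp_prob p (@has_hamilton_cycle_le R n.+1 M) <=
  (p * (expR 1 * (1 + M / n.+1%:R))) ^+ n.+1.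
Proof.
move=> n2 M0 p01; rewrite exprMn mulrC.
pose D := [set c : n.+1.-tuple 'I_n.+1 | uniq c && ((inversions c)%:R <= M)].
apply: (@le_trans _ _ (#|D|%:R * p ^+ n.+1)); last first.
  by rewrite ler_wpM2r ?exprn_ge0 ?count_few_inversions //; case/andP: p01.
have -> : #|D|%:R * p ^+ n.+1 = \sum_(c in D)
    rset_mean (edge_slots n.+1) p
      (fun G => (edge_set (thead c) (behead c) \subset G)%:R).
  rewrite mulr_natl -sumr_const; apply: eq_bigr => c; rewrite inE => /andP[+ _].
  case/tupleP: c => h s /= us; rewrite theadE.
  have ss : (1 < size s)%N by rewrite size_tuple.
  rewrite rset_mean_supset.
    by rewrite cardsE (card_uniqP (uniq_cycle_edges us ss)) size_cycle_edges size_tuple.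
  apply/subsetP => e; rewrite !inE => es; apply/eqP.
  by rewrite (card_cycle_edge us (ltnW ss)).
rewrite Gnp_probE exchange_big; apply: ler_sum => G _ /=.
rewrite -mulr_sumr ler_wpM2l ?rset_weight_ge0 //.
case: (boolP (has_hamilton_cycle_le M G)) => [|_]; last exact: sumr_ge0.
move=> /existsP[c /andP[/and3P[_ _ /andP[cG uc]] cM]].
rewrite (bigD1 c) ?inE ?uc //=; case/tupleP: c cG {uc cM} => h s cG.
by rewrite theadE /= -cycle_adjE cG lerDl sumr_ge0.
Qed.

End FirstMoment.

(** Constants: [4 * expR 1] comes from the spread, [2 * (1 + C)] from comparing [m] with [M / N],
    and 33 from at most [2 ln N + 1] rounds, whose total is at most
    [L + 16 + 32 ln N <= 33 ln N]. *)
Lemma hamilton_likely (R : realType) n (C M p L eps : R) (a : nat -> R) :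
  (2 <= n)%N -> 0 < C -> 2 * n.+1%:R <= M -> M <= C * n.+1%:R ^+ 2 ->
  L + 16 <= ln n.+1%:R ->
  33 * (4 * expR 1) * (2 * (1 + C)) * n.+1%:R * ln n.+1%:R / M <= p -> p <= 1 ->
  (forall j, 16 <= a j) ->
  (forall J, \sum_(j < J) a j <= L + 16 * J%:R /\
     \sum_(j < J) (4 / a j) ^+ (2 ^ j) <= eps) ->
  1 - eps <= Gnp_prob p (@has_hamilton_cycle_le R n.+1 M).
Proof.
move=> n2 C0 M2 MC Ln Kp p1 a16 aS.
set N : R := n.+1%:R in M2 MC Ln Kp.
have N0 : 0 < N by rewrite ltr0n.
have M0 : 0 < M by apply: lt_le_trans M2; rewrite mulr_gt0.
(* The cap at [n] is there because [M] may be as large as [C * N ^+ 2], while spread needs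
   [m <= n]. *)
pose m := minn (Num.truncn (M / N)) n.
have MN2 : 2 <= M / N by rewrite ler_pdivlMr.
have tle : (Num.truncn (M / N))%:R <= M / N by rewrite truncn_le // (le_trans _ MN2).
have tgt : M / N < (Num.truncn (M / N)).+1%:R by rewrite truncnS_gt.
have t2 : (2 <= Num.truncn (M / N))%N.
  by rewrite -ltnS -(ltr_nat R) (le_lt_trans MN2).
have mn : (2 <= m <= n)%N by rewrite geq_minr leq_min t2 n2.
have m0 : 0 < m%:R :> R by rewrite ltr0n; case/andP: mn => /ltnW.
have nmM : (n * m)%:R <= M.
  rewrite natrM; apply: (@le_trans _ _ (N * (M / N))); last by rewrite mulrC divfK ?gt_eqF.
  apply: ler_pM => //; first by rewrite ler_nat.
  by apply: le_trans tle; rewrite ler_nat geq_minl.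
(* Without the cap, [M < (m + 1) N <= 2 m N]; with it, [M <= C N ^ 2 <= 2 C n N]. *)
have invm : m%:R^-1 <= 2 * (1 + C) * N / M.
  rewrite ler_pdivlMr // ler_pdivrMl // /m.
  have [tn|nt] := leqP (Num.truncn (M / N)) n.
    have t2' : 2 <= (Num.truncn (M / N))%:R :> R by rewrite ler_nat.
    move: tgt; rewrite -natr1 ltr_pdivrMr // => tgt.
    set t := (Num.truncn _)%:R in t2' tgt *.
    have tN : (t + 1) * N <= 2 * t * N by rewrite ler_wpM2r ?(ltW N0) //; lra.
    have tCN : 0 <= t * N * C by rewrite !mulr_ge0 ?ltW //; lra.
    by nra.
  have nN : N <= 2 * n%:R by rewrite /N -natrM ler_nat mul2n -addnn -addn1 leq_add2l ltnW.
  apply: (le_trans MC); rewrite expr2.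
  have : C * (N * N) <= C * (N * (2 * n%:R)) by rewrite !ler_wpM2l // ltW.
  have : 0 <= n%:R * N by rewrite mulr_ge0 // ltW.
  lra.
set J := (trunc_log 2 n.+1).+1.
have nJ : (n.+1 < 2 ^ J)%N by exact: trunc_log_ltn.
(* Since [expR (1/2) <= 2], the inequality [2 ^ k <= N] gives [k / 2 <= ln N]. *)
have JN : J%:R <= 2 * ln N + 1.
  rewrite /J -[in leLHS]addn1 natrD lerD2r; set k := trunc_log 2 n.+1.
  rewrite -ler_pdivrMl // -[leLHS]expRK ler_ln ?posrE ?expR_gt0 //.
  have kN : 2 ^+ k <= N by rewrite -natrX ler_nat trunc_logP.
  apply: le_trans kN; rewrite mulrC expRM_natl lerXn2r ?nnegrE ?expR_ge0 //.
  have := expR_ge1Dx (- 2^-1 : R); have := expRxMexpNx_1 (2^-1 : R); have := expR_gt0 (2^-1 : R).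
  nra.
have [aJ fJ] := aS J.
have lnN : 0 <= ln N by apply: ln_ge0; rewrite ler1n.
have a1 j : 1 <= a j by apply: le_trans (a16 j); rewrite ler1n.
apply: (le_trans (_ : _ <= 1 - \sum_(j < J) (4 / a j) ^+ (2 ^ j))); first by rewrite lerD2l lerN2.
apply: (hamilton_prob_ge mn nJ nmM a1 _ p1).
apply: le_trans Kp.
apply: (@le_trans _ _ ((4 * expR 1) * (2 * (1 + C) * N / M) * (33 * ln N))); last first.
  by rewrite le_eqVlt; apply/orP; left; apply/eqP; ring.
apply: ler_pM.
- by rewrite divr_ge0 ?mulr_ge0 ?expR_ge0 // ltW.
- by apply: sumr_ge0 => j _; apply: le_trans (a1 j).
- by rewrite ler_wpM2l // mulr_ge0 ?expR_ge0.
- by apply: (le_trans aJ); lra.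
Qed.

(** * Passage to the limit *)

Lemma near_ln_ge (R : realType) (x : R) : \forall n \near \oo%classic, x <= ln n%:R.
Proof.
near=> n; rewrite -[leLHS]expRK ler_ln ?posrE ?expR_gt0 //.
  by near: n; exact: nbhs_infty_ger.
rewrite (lt_le_trans (expR_gt0 x)) //; near: n; exact: nbhs_infty_ger.
Unshelve. all: by end_near. Qed.

Local Open Scope classical_set_scope.
Local Open Scope ring_scope.

(** The bound [M n <= C * n ^ 2] keeps [n log n / M] at order at least [log n / n]; well below that
    density a random graph has isolated vertices with high probability. [K] depends on [C] only. *)
Theorem theorem6 (R : realType) :
  (forall C : R, 0 < C ->
   exists2 K : R, 0 < K &
   forall M : nat -> R,
     (exists2 c : R, 0 < c &
        \forall n \near \oo, c * (n%:R * ln n%:R) <= M n) ->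
     (\forall n \near \oo, M n <= C * n%:R ^+ 2) ->
   forall p : nat -> R,
     (forall n, 0 <= p n <= 1) ->
     (\forall n \near \oo, K * n%:R * ln n%:R / M n <= p n) ->
     Gnp_prob (p n) (@has_hamilton_cycle_le R n (M n)) @[n --> \oo] --> (1 : R))
  /\
  (forall M : nat -> R,
     (exists2 c : R, 0 < c &
        \forall n \near \oo, c * (n%:R * ln n%:R) <= M n) ->
   forall eps : R, 0 < eps ->
   forall p : nat -> R,
     (forall n, 0 <= p n <= 1) ->
     (\forall n \near \oo, p n <= (1 - eps) * n%:R / (expR 1 * M n)) ->
     Gnp_prob (p n) (fun G : {set {set 'I_n}} => ~~ has_hamilton_cycle_le (M n) G)
       @[n --> \oo] --> (1 : R)).
Proof.
split=> [C C0|M [c c0 McN] eps eps0 p p01 pM].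
  exists (33 * (4 * expR 1) * (2 * (1 + C))).
    by rewrite !mulr_gt0 ?expR_gt0 // addr_gt0.
  move=> M [c c0 McN] MC p p01 pM; apply/cvgrPdist_le => eps eps0.
  have [L [a a16 aS]] := round_densities eps0.
  near=> n.
  have n3 : (3 <= n)%N by near: n; exact: nbhs_infty_ge.
  have Mn : c * (n%:R * ln n%:R) <= M n by near: n.
  have MCn : M n <= C * n%:R ^+ 2 by near: n.
  have pn : 33 * (4 * expR 1) * (2 * (1 + C)) * n%:R * ln n%:R / M n <= p n by near: n.
  have lnL : L + 16 <= ln n%:R by near: n; exact: near_ln_ge.
  have lnc : 2 / c <= ln n%:R by near: n; exact: near_ln_ge.
  have /andP[_ p1] := p01 n.
  rewrite ger0_norm ?subr_ge0 ?Gnp_prob_le1 // lerBlDr -lerBlDl.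
  have M2 : 2 * n%:R <= M n.
    apply: le_trans Mn; rewrite mulrCA [2 * _]mulrC ler_wpM2l //.
    by rewrite -ler_pdivrMl // mulrC.
  move: n3 M2 MCn pn lnL p1; case: (n) => // k k2 M2 MCk pk lnL p1.
  exact: (hamilton_likely k2 C0 M2 MCk lnL pk p1 a16 aS).
(* Once [n / M n <= eps], the base in the first-moment bound is at most [(1 - eps) * (1 + eps)]; the
   maximum keeps [z] nonnegative when [eps > 1]. *)
pose z : R := Num.max 0 (1 - eps ^+ 2).
have z0 : 0 <= z by rewrite le_max lexx.
have z1 : `|z| < 1.
  by rewrite ger0_norm // gt_max ltr01 /= ltrBlDr ltrDl exprn_gt0.
apply/cvgrPdist_le => d d0.
near=> n.
have n3 : (3 <= n)%N by near: n; exact: nbhs_infty_ge.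
have Mn : c * (n%:R * ln n%:R) <= M n by near: n.
have pn : p n <= (1 - eps) * n%:R / (expR 1 * M n) by near: n.
have lnc : (c * eps)^-1 <= ln n%:R by near: n; exact: near_ln_ge.
have zn : z ^+ n <= d.
  have : `|0 - z ^+ n| <= d by near: n; have /cvgrPdist_le/(_ _ d0) := cvg_expr z1.
  by rewrite sub0r normrN ger0_norm ?exprn_ge0.
have n0 : 0 < n%:R :> R by rewrite ltr0n (leq_trans _ n3).
have /andP[p0 p1] := p01 n.
have Mne : n%:R <= eps * M n.
  rewrite -ler_pdivrMl //; apply: le_trans Mn.
  rewrite mulrC mulrCA ler_wpM2l ?(ltW n0) //.
  by rewrite -ler_pdivrMl // -invfM.
have M0 : 0 < M n by rewrite -(pmulr_rgt0 _ eps0) (lt_le_trans n0).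
have -> : 1 - Gnp_prob (p n) (fun G : {set {set 'I_n}} => ~~ has_hamilton_cycle_le (M n) G) =
    Gnp_prob (p n) (@has_hamilton_cycle_le R n (M n)).
  exact/esym/Gnp_probC.
rewrite ger0_norm; last first.
  by rewrite Gnp_probE rset_mean_ge0 // => G; rewrite ler0n.
apply: le_trans zn.
move: n3 n0 Mne M0 p0 p1 pn; case: (n) => // k k2 k0 Mke M0 p0 p1 pk.
apply: (le_trans (hamilton_prob_le k2 M0 (p01 _))).
have w0 : 0 < expR 1 * (1 + M k.+1 / k.+1%:R) :> R.
  by rewrite mulr_gt0 ?expR_gt0 // addr_gt0 // divr_gt0.
rewrite lerXn2r ?nnegrE //; first by rewrite mulr_ge0 // ltW.
rewrite le_max; apply/orP; right.
have H := ler_wpM2r (ltW w0) pk.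
have E : (1 - eps) * k.+1%:R / (expR 1 * M k.+1) * (expR 1 * (1 + M k.+1 / k.+1%:R)) =
    (1 - eps) * (1 + k.+1%:R / M k.+1).
  by field; rewrite !gt_eqF ?expR_gt0.
rewrite E in H; apply: (le_trans H).
have le_eps : k.+1%:R / M k.+1 <= eps by rewrite ler_pdivrMr.
(* The upper bound [H] dominates a nonnegative quantity, which forces [eps <= 1]. *)
have eps1 : 0 <= 1 - eps.
  rewrite -(pmulr_lge0 _ (_ : 0 < 1 + k.+1%:R / M k.+1)) ?addr_gt0 ?divr_gt0 //.
  by apply: le_trans H; rewrite mulr_ge0 // ltW.
nra.
Unshelve. all: by end_near. Qed.
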